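(* Let $n\ge2$, $s\ge2$, and $H_n^s=\sum_{j=1}^n\frac1{j^s}$. The star graph with $n$ leaves is a Nash equilibrium when nodes transact with each other according to the Zipf distribution with parameter $s$ whenever the cost of all edges is equal (to $l$), and $\dfrac{a}{H_n^s}\le l$ and $\dfrac{b}{H_n^s}\le l$.
   Context: A payment channel network is an undirected graph on a set $V$ of players (each channel = two opposite directed edges). All channels cost $l>0$ to a player: the channel cost of a player $u$ is $l$ times the number of channels incident to $u$. Zipf transaction distribution with parameter $s\ge 0$ (version averaged over ties): for a node $u$ in a graph on $V$, delete $u$ and its incident edges, obtaining a graph on $V'=V\setminus\{u\}$. Rank the nodes of $V'$ by (in-)degree (rank 1 = highest). For $v\in V'$ let $r_0(v)$ be the smallest rank of a node with the same degree as $v$, and $n(v)$ the number of nodes of $V'$ with that degree. Set $rf(v)=\frac{1}{n(v)}\sum_{j=r_0(v)}^{r_0(v)+n(v)-1}j^{-s}$ and $p^{trans}_{u,v}=rf(v)/\sum_{v'\in V'}rf(v')$, the probability that $u$ transacts with $v$. Expected revenue of $u$: $\mathbb{E}^{rev}_u=b\sum_{v_1\neq v_2,\ v_1,v_2\in V\setminus\{u\}}\frac{m_u(v_1,v_2)}{m(v_1,v_2)}p^{trans}_{v_1,v_2}$ (ordered pairs), where $m(v_1,v_2)$ is the number of shortest paths from $v_1$ to $v_2$, $m_u(v_1,v_2)$ the number of those passing through $u$ as an intermediary, and $b=N_{v_1}f_{avg}>0$ is assumed constant ($N_v$ = average number of transactions sent by $v$ per unit time, $f_{avg}$ = average fee).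 Expected fees of $u$: $\mathbb{E}^{fees}_u=a\sum_{v\neq u}d(u,v)\,p^{trans}_{u,v}$, where $a=N_uf^T_{avg}>0$ ($f^T_{avg}$ = average fee paid to each intermediary) and $d(u,v)$ is the shortest path length, $+\infty$ if disconnected. Utility of $u$: $\mathbb{E}^{rev}_u-\mathbb{E}^{fees}_u-(\text{channel cost of }u)$, which is $-\infty$ for a disconnected node. All quantities (including $p^{trans}$) are computed in the current graph. A unilateral deviation of $u$ replaces the set of channels incident to $u$ by any other set of channels incident to $u$ (adding and/or removing channels), all other channels being unchanged. A graph is a Nash equilibrium if no player can strictly increase its utility by a unilateral deviation. *)

(* Defs.v *)
From HB Require Import structures.
From mathcomp Require Import all_boot all_order all_algebra.
From mathcomp Require Import reals constructive_ereal exp.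

Set Implicit Arguments.
Unset Strict Implicit.
Unset Printing Implicit Defensive.

Import Order.TTheory GRing.Theory Num.Theory.
Local Open Scope ring_scope.

(* An adjacent pair {x, y} is one channel, i.e. two opposite directed edges;
   in-degree, out-degree and number of incident channels therefore coincide. *)
Record network (V : finType) := Network {
  channel :> rel V;
  channel_sym : symmetric channel;
  channel_irr : irreflexive channel }.

Definition degree (V : finType) (g : network V) (u : V) : nat :=
  #|[set w | g u w]|.

(* In degree_del, ranking, r0, nties and rf, the node u is the deleted one and the
   other nodes are taken in the graph induced on V \ {u}. *)
Definition degree_del (V : finType) (g : network V) (u v : V) : nat :=
  #|[set w | (w != u) && g v w]|.

(* The position (from 0) of a node in this sequence is its rank minus 1; the
   order chosen between nodes of equal degree is irrelevant below. *)
Definition ranking (V : finType) (g : network V) (u : V) : seq V :=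
  sort (fun x y => (degree_del g u y <= degree_del g u x)%N)
       (enum [set~ u]).

Definition r0 (V : finType) (g : network V) (u v : V) : nat :=
  (find (fun w => degree_del g u w == degree_del g u v) (ranking g u)).+1.

Definition nties (V : finType) (g : network V) (u v : V) : nat :=
  #|[set w | (w != u) && (degree_del g u w == degree_del g u v)]|.

Definition rf (R : realType) (s : R) (V : finType) (g : network V) (u v : V)
    : R :=
  (nties g u v)%:R^-1 *
  \sum_(r0 g u v <= j < r0 g u v + nties g u v) powR j%:R (- s).

Definition ptrans (R : realType) (s : R) (V : finType) (g : network V)
    (u v : V) : R :=
  rf s g u v / \sum_(v' | v' != u) rf s g u v'.

(* A path from x is given by the sequence of its nodes other than x, so that
   the size of the sequence is the length of the path. *)
Definition paths (V : finType) (g : network V) (x y : V) (k : nat)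
    : {set k.-tuple V} :=
  [set p : k.-tuple V | [&& path g x p, uniq (x :: p) & last x p == y]].

(* This is #|V|, which is not the length of any path, when y is not reachable
   from x. *)
Definition hops (V : finType) (g : network V) (x y : V) : nat :=
  find (fun k => paths g x y k != set0) (iota 0 #|V|).

Definition dist (R : realType) (V : finType) (g : network V) (x y : V)
    : \bar R :=
  if connect g x y then ((hops g x y)%:R)%:E else +oo%E.

Definition nshortest (V : finType) (g : network V) (x y : V) : nat :=
  #|paths g x y (hops g x y)|.

Definition nshortest_via (V : finType) (g : network V) (u x y : V) : nat :=
  #|[set p in paths g x y (hops g x y) | [&& u != x, u != y & u \in tval p]]|.

(* Disconnected pairs contribute 0 / 0 = 0. *)
Definition revenue (R : realType) (s b : R) (V : finType) (g : network V)
    (u : V) : R :=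
  b * \sum_(v1 | v1 != u) \sum_(v2 | (v2 != u) && (v1 != v2))
        (nshortest_via g u v1 v2)%:R / (nshortest g v1 v2)%:R
        * ptrans s g v1 v2.

Definition fees (R : realType) (s a : R) (V : finType) (g : network V)
    (u : V) : \bar R :=
  (a%:E * \sum_(v | v != u) (dist R g u v * (ptrans s g u v)%:E))%E.

Definition channel_cost (R : realType) (l : R) (V : finType) (g : network V)
    (u : V) : R :=
  l * (degree g u)%:R.

(* Every ptrans s g u v with v != u is positive, so for a > 0 a node that
   cannot reach some other node has fees +oo, hence utility -oo. *)
Definition utility (R : realType) (s a b l : R) (V : finType) (g : network V)
    (u : V) : \bar R :=
  ((revenue s b g u)%:E - fees s a g u - (channel_cost l g u)%:E)%E.

Definition deviation (V : finType) (u : V) (g g' : network V) : Prop :=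
  forall x y : V, x != u -> y != u -> g' x y = g x y.

Definition nash_equilibrium (R : realType) (s a b l : R) (V : finType)
    (g : network V) : Prop :=
  forall (u : V) (g' : network V), deviation u g g' ->
    ~ (utility s a b l g u < utility s a b l g' u)%E.

Definition star_rel (V : finType) (c : V) : rel V :=
  fun x y => (x != y) && ((x == c) || (y == c)).

Lemma star_sym (V : finType) (c : V) : symmetric (star_rel c).
Proof. by move=> x y; rewrite /star_rel eq_sym orbC. Qed.

Lemma star_irr (V : finType) (c : V) : irreflexive (star_rel c).
Proof. by move=> x; rewrite /star_rel eqxx. Qed.

(* The star with centre c; it has #|V| - 1 leaves. *)
Definition star (V : finType) (c : V) : network V :=
  Network (@star_sym V c) (@star_irr V c).

Definition gen_harmonic (R : realType) (n : nat) (s : R) : R :=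
  \sum_(1 <= j < n.+1) 1 / powR j%:R s.

(* Main.v *)
Require Import Defs.
From mathcomp Require Import all_boot all_order all_algebra.
From mathcomp Require Import boolp reals constructive_ereal exp ring lra zify.
Import Order.TTheory GRing.Theory Num.Theory.
Local Open Scope ring_scope.

Set Implicit Arguments.
Unset Strict Implicit.
Unset Printing Implicit Defensive.

(* The centre cannot drop a channel without disconnecting a leaf.  A leaf u does
   not influence its own transaction probabilities, which are rc / H for the
   centre and rl / H for each of the m = n - 1 other leaves, where H = H_n^s and
   m rl <= rc <= 1.  Suppose that u has channels to k leaves.  It then
   earns only on ordered pairs of these leaves, and at most half of the traffic
   of each pair since the centre lies on the other shortest path.  Seen from one
   of them, the remaining k - 1 receive at most H_(k-1)^s / H <= 2 (k - 1) / (k H) of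
   the transactions, so the revenue is at most b (k - 1) / H <= l (k - 1).  If u
   keeps its channel to the centre, it saves fees of at most
   a k rl / H <= a / H <= l (none if k = 0) and pays l k more for channels.
   Otherwise k >= 1, or u would be disconnected; u pays l (k - 1) more for
   channels and a (rc - (2 k - m) rl) / H >= 0 more in fees. *)

(** * Sums along a nonincreasing sequence *)

(** Equal entries of a nonincreasing sequence are contiguous. This converts the block of tied ranks
    in [rf] into the set of positions that carry a given degree. *)
Lemma sum_sorted_block (U : nmodType) (F : nat -> U) (x : nat) (t : seq nat) :
  sorted geq t ->
  \sum_(index x t <= i < index x t + count_mem x t) F i =
  \sum_(0 <= i < size t | nth 0%N t i == x) F i.
Proof.
elim: t F => [|y t IHt] F st; first by rewrite !big_geq.
have {IHt} IHt := IHt (F \o succn) (path_sorted st).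
rewrite [RHS]big_ltn_cond // big_add1 /=.
have [yx | yx] := eqVneq y x; last first.
  by rewrite add0n addSn big_add1 /= IHt.
rewrite add0n add1n big_ltn // big_add1 /= -IHt; congr (_ + _).
case: t st {IHt} => [|z t] /=; first by rewrite !big_geq.
case/andP=> zy st; have [_ | zx] := eqVneq z x; first by rewrite add0n.
(* The entry [z] after [y = x] differs from [x], so it is smaller, and [x] cannot reappear later. *)
have nx : x \notin t.
  have /allP gt := order_path_min (rev_trans leq_trans) st.
  by apply/negP => /gt /= xz; move: zx; rewrite eqn_leq xz -yx zy.
by rewrite (count_memPn nx) !addn0 !big_geq.
Qed.

(** Moving mass to earlier positions can only help, and no position holds more than 1. It is applied
    with [w i] the share of rank [i + 1] that falls to a set of [k] nodes. *)
Lemma sum_top_weights (R : realType) (F : nat -> R) (w : nat -> R) (N k : nat) :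
  (forall i j, (i <= j)%N -> F j <= F i) ->
  (forall i, 0 <= w i <= 1) ->
  \sum_(0 <= i < N) w i = k%:R -> (k <= N)%N ->
  \sum_(0 <= i < N) w i * F i <= \sum_(0 <= i < k) F i.
Proof.
move=> antiF w01 sumw kN.
have truncE (G : nat -> R) :
    \sum_(0 <= i < k) G i = \sum_(0 <= i < N) (i < k)%:R * G i.
  rewrite (big_nat_widen _ _ _ _ _ kN) big_mkcond /=.
  by apply: eq_bigr => i _; case: ifP; rewrite (mul1r, mul0r).
have sumk : \sum_(0 <= i < N) (i < k)%:R = k%:R :> R.
  under eq_bigr do rewrite -[_%:R]mulr1.
  by rewrite -truncE big_const_nat subn0 iter_addr_0.
rewrite truncE.
(* Both weightings have total mass k, so F may be shifted by the constant F k. *)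
rewrite -subr_ge0 -sumrB.
have -> : \sum_(0 <= i < N) ((i < k)%:R * F i - w i * F i) =
    \sum_(0 <= i < N) ((i < k)%:R - w i) * (F i - F k).
  have e : (\sum_(0 <= i < N) ((i < k)%:R - w i)) * F k = 0.
    by rewrite sumrB sumk sumw subrr mul0r.
  rewrite -[LHS]subr0 -[X in _ - X]e mulr_suml -sumrB.
  by apply: eq_bigr => i _; rewrite -mulrBl -mulrBr.
apply: sumr_ge0 => i _; have /andP[w0 w1] := w01 i.
(* Both factors are nonnegative for [i < k] and nonpositive for [i >= k]. *)
case: (ltnP i k) => ik /=.
  by rewrite mulr_ge0 ?subr_ge0 // antiF // ltnW.
by rewrite mulr_le0 ?subr_le0 // antiF.
Qed.

(** * Generalized harmonic numbers *)

Section GenHarmonic.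
Variables (R : realType) (s : R).

Lemma powRN_anti (hs : 2 <= s) (i j : nat) : (i <= j)%N ->
  powR j.+1%:R (- s) <= powR i.+1%:R (- s) :> R.
Proof.
move=> ij; rewrite !powRN lef_pV2 ?posrE ?powR_gt0 ?ltr0n //.
by rewrite ge0_ler_powR ?nnegrE ?ler0n ?ler_nat //; lra.
Qed.

Lemma gen_harmonicE (n : nat) :
  gen_harmonic n s = \sum_(0 <= i < n) powR i.+1%:R (- s) :> R.
Proof.
by rewrite /gen_harmonic big_add1 /=; apply: eq_bigr => i _; rewrite powRN div1r.
Qed.

Lemma gen_harmonicS (n : nat) :
  gen_harmonic n.+1 s = gen_harmonic n s + powR n.+1%:R (- s).
Proof. by rewrite !gen_harmonicE big_nat_recr. Qed.

Lemma gen_harmonic1 : gen_harmonic 1 s = 1.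
Proof. by rewrite gen_harmonicE big_nat1 powRN powR1 invr1. Qed.

Lemma gen_harmonic_gt0 (n : nat) : (0 < n)%N -> 0 < gen_harmonic n s.
Proof.
case: n => // n _; elim: n => [|n IHn]; first by rewrite gen_harmonic1.
by rewrite gen_harmonicS; have := powR_ge0 n.+2%:R (- s); lra.
Qed.

(** Induction, using that [s >= 2] bounds each new term by an inverse square. With [y = n + 2], the
    step reduces to [y + 1 <= 2 y]. *)
Lemma gen_harmonic_le (n : nat) : 2 <= s ->
  n.+1%:R * gen_harmonic n s <= 2 * n%:R.
Proof.
move=> hs; case: n => [|n]; first by rewrite gen_harmonicE big_geq // !mulr0.
elim: n => [|n IHn]; first by rewrite gen_harmonic1; lra.
have := IHn; rewrite [gen_harmonic n.+2 s]gen_harmonicS.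
have : powR n.+2%:R (- s) <= (n.+2%:R ^+ 2)^-1 :> R.
  rewrite powRN lef_pV2 ?posrE ?powR_gt0 ?exprn_gt0 ?ltr0n //.
  by rewrite -powR_mulrn ?ler0n // ler_powR // ler1n.
set H := gen_harmonic n.+1 s; set f := powR _ _ => hf hH.
have h : n.+2%:R ^+ 2 * f <= 1.
  by rewrite mulrC -ler_pdivlMr ?exprn_gt0 ?ltr0n // div1r.
have : 1 <= n.+2%:R :> R by rewrite ler1n.
move: hH h; rewrite -[n.+3]addn1.
have -> : n.+1%:R = n.+2%:R - 1 :> R by rewrite -[n.+2]addn1 natrD addrK.
rewrite natrD; move: n.+2%:R => y hH h y1.
have y0 : 0 <= y + 1 by lra.
have /(ler_wpM2l y0) A : y * (y * H) <= y * (2 * (y - 1)) by rewrite ler_wpM2l //; lra.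
have y2 : 0 < y ^+ 2 by rewrite exprn_gt0 //; lra.
have B := ler_wpM2l y0 h.
rewrite -(ler_pM2l y2); lra.
Qed.
End GenHarmonic.

(** * Ranking factors in an arbitrary network *)

Section Ranking.
Variables (R : realType) (s : R) (V : finType) (g : network V) (u : V).
Hypothesis hs : 2 <= s.
Let d := degree_del g u.
Let t := [seq d w | w <- ranking g u].

Lemma sorted_degrees : sorted geq t.
Proof.
rewrite sorted_map; apply: sort_sorted => x y /=; exact: leq_total.
Qed.

Lemma perm_ranking : perm_eq (ranking g u) (enum [set~ u]).
Proof. by rewrite perm_sort. Qed.

Lemma size_degrees : size t = #|[set~ u]|.
Proof. by rewrite size_map (perm_size perm_ranking) cardE. Qed.

Lemma mem_ranking w : (w \in ranking g u) = (w != u).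
Proof. by rewrite (perm_mem perm_ranking) mem_enum !inE. Qed.

Lemma count_degrees v : count_mem (d v) t = nties g u v.
Proof.
rewrite count_map (permP perm_ranking) -size_filter /nties cardE.
apply/perm_size/uniq_perm; [by rewrite filter_uniq // enum_uniq | exact: enum_uniq |] => w.
by rewrite mem_filter !mem_enum !inE andbC.
Qed.

Lemma nties_gt0 v : v != u -> (0 < nties g u v)%N.
Proof. by move=> vu; apply/card_gt0P; exists v; rewrite inE vu eqxx. Qed.

Lemma rfE v : rf s g u v = (nties g u v)%:R^-1 *
  \sum_(0 <= i < size t | nth 0%N t i == d v) powR i.+1%:R (- s).
Proof.
rewrite /rf -(sum_sorted_block (fun i => powR i.+1%:R (- s)) _ sorted_degrees).
(* Ranks start at 1 and positions at 0, hence the shift by one. *)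
rewrite count_degrees /r0 addSn big_add1 /=; congr (_ * _).
by rewrite /t /index find_map.
Qed.

Lemma rf_degree v w : d v = d w -> rf s g u v = rf s g u w.
Proof.
move=> e; rewrite !rfE e; congr (_%:R^-1 * _).
by rewrite -!count_degrees e.
Qed.

Lemma rf_ge0 v : 0 <= rf s g u v.
Proof. by rewrite mulr_ge0 ?invr_ge0 ?ler0n ?sumr_ge0 // => *; exact: powR_ge0. Qed.

Lemma rf_gt0 v : v != u -> 0 < rf s g u v.
Proof.
move=> vu; rewrite /rf mulr_gt0 ?invr_gt0 ?ltr0n ?nties_gt0 //.
rewrite big_ltn ?ltr_wpDr ?sumr_ge0 //; try by move=> *; exact: powR_ge0.
  by rewrite powR_gt0 // ltr0n.
by rewrite -[X in (X < _)%N]addn0 ltn_add2l nties_gt0.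
Qed.

(** The share of rank [i + 1] that falls to [A]: averaging over ties splits each rank equally among
    all nodes of the degree found there. *)
Definition rank_weight (A : {set V}) (i : nat) : R :=
  \sum_(v in A | nth 0%N t i == d v) (nties g u v)%:R^-1.

Lemma sum_rfE (A : {set V}) :
  \sum_(v in A) rf s g u v =
  \sum_(0 <= i < size t) rank_weight A i * powR i.+1%:R (- s).
Proof.
under eq_bigr do rewrite rfE mulr_sumr big_mkcond.
rewrite exchange_big /=; apply: eq_bigr => i _.
by rewrite mulr_suml -big_mkcondr.
Qed.

Lemma rank_weightE (A : {set V}) (i : nat) : rank_weight A i =
  #|[set v in A | d v == nth 0%N t i]|%:R /
  #|[set v | (v != u) && (d v == nth 0%N t i)]|%:R.
Proof.
rewrite /rank_weight; set x := nth _ _ _.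
rewrite (eq_bigr (fun _ => #|[set v | (v != u) && (d v == x)]|%:R^-1)).
  rewrite sumr_const -[LHS]mulr_natl; congr (_%:R * _).
  by apply: eq_card => v; rewrite !inE eq_sym.
by move=> v /andP[_ /eqP ->].
Qed.

Lemma rank_weight_setC1 (i : nat) : (i < size t)%N -> rank_weight [set~ u] i = 1.
Proof.
move=> ht; have /mapP[v] := mem_nth 0%N ht; rewrite mem_ranking => vu e.
rewrite rank_weightE.
have -> : [set x in [set~ u] | d x == nth 0%N t i] =
    [set x | (x != u) && (d x == nth 0%N t i)] by apply/setP => x; rewrite !inE.
rewrite divff // pnatr_eq0 -lt0n; apply/card_gt0P; exists v.
by rewrite inE vu e eqxx.
Qed.

Lemma rank_weight_le1 (A : {set V}) (i : nat) : u \notin A ->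
  0 <= rank_weight A i <= 1.
Proof.
move=> uA; rewrite rank_weightE; set N := #|[set v | (v != u) && _]|.
have : (#|[set v in A | d v == nth 0%N t i]| <= N)%N.
  apply/subset_leq_card/subsetP => v; rewrite !inE => /andP[vA ->].
  by rewrite andbT; apply: contraNneq uA => <-.
(* No node has this degree, which happens only for [i] beyond the end of [t]; the quotient is then
   0. *)
case: N => [|N]; first by rewrite invr0 mulr0 ler01 lexx.
by move=> le; rewrite divr_ge0 ?ler0n //= ler_pdivrMr ?ltr0n // mul1r ler_nat.
Qed.

(** Each node of [A] takes a share [1 / nties] of each of its [nties] tied positions, so 1 in
    total. *)
Lemma sum_rank_weight (A : {set V}) : u \notin A ->
  \sum_(0 <= i < size t) rank_weight A i = #|A|%:R.
Proof.
move=> uA; under eq_bigr do rewrite /rank_weight big_mkcondr.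
rewrite exchange_big /= -sumr_const; apply: eq_bigr => v vA.
have vu : v != u by apply: contraNneq uA => <-.
rewrite -big_mkcond -(big_nth 0%N (fun x => x == d v) (fun _ => (nties g u v)%:R^-1)).
rewrite big_const_seq iter_addr_0 count_degrees -[LHS]mulr_natl divff //.
by rewrite pnatr_eq0 -lt0n nties_gt0.
Qed.

(** Every rank is shared out completely, so the normalizing constant of [ptrans] is the same in all
    networks on [V]. *)
Lemma sum_rf_setC1 :
  \sum_(v | v != u) rf s g u v = gen_harmonic #|[set~ u]| s.
Proof.
transitivity (\sum_(v in [set~ u]) rf s g u v).
  by apply: eq_bigl => v; rewrite !inE.
rewrite sum_rfE gen_harmonicE -size_degrees.
rewrite big_nat_cond [RHS]big_nat_cond; apply: eq_bigr => i.
by rewrite andbT => /andP[_ ht]; rewrite rank_weight_setC1 // mul1r.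
Qed.

(** The best case for [A] is to occupy the first [#|A|] ranks alone. *)
Lemma sum_rf_le (A : {set V}) : u \notin A ->
  \sum_(v in A) rf s g u v <= gen_harmonic #|A| s.
Proof.
move=> uA; rewrite sum_rfE gen_harmonicE.
apply: (sum_top_weights (F := fun i => powR i.+1%:R (- s))) => [i j|i||].
- exact: powRN_anti.
- exact: rank_weight_le1.
- exact: sum_rank_weight.
rewrite size_degrees; apply/subset_leq_card/subsetP => v vA.
by rewrite !inE; apply: contraNneq uA => <-.
Qed.

Lemma rf_le1 v : v != u -> rf s g u v <= 1.
Proof.
move=> vu; have := @sum_rf_le [set v].
by rewrite inE eq_sym vu big_set1 cards1 gen_harmonic1; apply.
Qed.
End Ranking.

(** * Degrees and ranking factors seen from a deviating leaf *)

Section LeafDeviation.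
Variables (V : finType) (c u : V) (g : network V) (n : nat).
Hypothesis hV : #|V| = n.+1.
Hypotheses (uc : u != c) (gP : deviation u (star c) g).
Lemma card_leaves : #|[set v | (v != u) && (v != c)]| = n.-1.
Proof.
have -> : [set v | (v != u) && (v != c)] = ~: [set u; c].
  by apply/setP => v; rewrite !inE negb_or.
by rewrite cardsCs setCK cards2 uc hV subn2.
Qed.

Lemma degree_del_centre : degree_del g u c = n.-1.
Proof.
rewrite -card_leaves; apply: eq_card => v; rewrite !inE.
have [//|vu /=] := eqVneq v u.
by rewrite gP // 1?eq_sym //= /star_rel eqxx andbT.
Qed.

Lemma degree_del_leaf v : v != u -> v != c -> degree_del g u v = 1%N.
Proof.
move=> vu vc; rewrite -(cards1 c); apply: eq_card => x; rewrite !inE.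
have [->|xu /=] := eqVneq x u; first by rewrite (negbTE uc).
by rewrite gP //= /star_rel (negbTE vc) /=; case: (eqVneq x c) => [->|]; rewrite ?andbF ?vc.
Qed.

(** Without [u], the centre has degree [n - 1 > 1] and every other leaf degree 1, so the centre
    comes first in the sorted order. *)
Lemma ranking_centre : (2 < n)%N -> r0 g u c = 1%N.
Proof.
move=> n2; have := sorted_degrees g u; have := mem_ranking g u.
rewrite /r0; case: (ranking g u) => [|y r] mem_r; first by have := mem_r c; rewrite eq_sym uc.
rewrite /= => /(order_path_min (rev_trans leq_trans)) /allP le.
have [-> | yc] := eqVneq y c; first by rewrite eqxx.
have yu : y != u by rewrite -mem_r mem_head.
have cr : c \in r by have := mem_r c; rewrite inE eq_sym (negbTE yc) /= eq_sym uc.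
have := le _ (map_f (degree_del g u) cr).
by rewrite /= degree_del_centre degree_del_leaf //; lia.
Qed.

Variables (R : realType) (s : R).
Local Notation H := (gen_harmonic n s).

Lemma sum_rf_others : \sum_(v | v != u) rf s g u v = H.
Proof.
by rewrite sum_rf_setC1 cardsC1 hV.
Qed.

Hypothesis hn : (2 <= n)%N.

(** The value does not involve [g]: a leaf cannot influence it. For [n = 2] the centre ties with the
    only other leaf and they share [H] equally; otherwise it holds rank 1 alone. *)
Lemma rf_centre : rf s g u c = if n == 2%N then H / 2 else 1.
Proof.
have cu : c != u by rewrite eq_sym.
case: eqP => [n2 | n2].
  rewrite -sum_rf_others (eq_bigr (fun _ => rf s g u c)) => [|v vu].
    rewrite sumr_const; have -> : #|[pred v | v != u]| = 2%N; last by field.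
    by have := cardC1 u; rewrite hV n2.
  apply: rf_degree; have [->//|vc] := eqVneq v c.
  by rewrite degree_del_centre degree_del_leaf // n2.
have {n2} n2 : (2 < n)%N by lia.
have nt : nties g u c = 1%N.
  rewrite -(cards1 c); apply: eq_card => v; rewrite !inE.
  have [->|vu /=] := eqVneq v u; first by rewrite (negbTE uc).
  have [->|vc] := eqVneq v c; first by rewrite eqxx.
  by rewrite degree_del_centre degree_del_leaf //; lia.
by rewrite /rf ranking_centre // nt invr1 mul1r big_nat1 powR1.
Qed.

(** The other leaves all have degree 1, so they share equally what the centre leaves of [H]. *)
Lemma rf_leaf v : v != u -> v != c -> rf s g u v = (H - rf s g u c) / n.-1%:R.
Proof.
have cu : c != u by rewrite eq_sym.
move=> vu vc; rewrite -sum_rf_others (bigD1 c) //= [_ - _]addrC addKr.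
rewrite (eq_bigr (fun _ => rf s g u v)) => [|w /andP[wu wc]]; last first.
  by apply: rf_degree; rewrite !degree_del_leaf.
rewrite sumr_const; have -> : #|[pred w | (w != u) && (w != c)]| = n.-1.
  by rewrite -card_leaves; apply: eq_card => w; rewrite !inE.
by rewrite -[X in X / _]mulr_natr mulfK // pnatr_eq0 -lt0n ltn_predRL.
Qed.

(** For [n = 2] the two sides of the first inequality are equal; otherwise the centre has factor 1,
    and [gen_harmonic_le] gives [H <= 2]. *)
Lemma rf_leaves_le_centre : 2 <= s -> H - rf s g u c <= rf s g u c <= 1.
Proof.
move=> hs; rewrite rf_le1 1?eq_sym // andbT rf_centre; case: eqP => _; first by lra.
have := gen_harmonic_le n hs.
have n0 : 0 < n.+1%:R :> R by rewrite ltr0n.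
have : 2 * n%:R <= n.+1%:R * 2 :> R by rewrite -!natrM ler_nat; lia.
move=> h2 h1; have := le_trans h1 h2; rewrite ler_pM2l //; lra.
Qed.
End LeafDeviation.

(** * Shortest paths of length one and two *)

Section Paths.
Variables (V : finType) (g : network V).
Implicit Types (x y : V) (k : nat).

Lemma hops_le x y k (p : k.-tuple V) : p \in paths g x y k -> (hops g x y <= k)%N.
Proof.
move=> hp; rewrite leqNgt; apply/negP => lt.
have := before_find 0%N lt; have := find_size (fun k => paths g x y k != set0) (iota 0 #|V|).
rewrite size_iota => le; rewrite nth_iota ?(leq_trans lt) // add0n.
by move/negbFE/eqP => e; rewrite e inE in hp.
Qed.

(** The bound [k <= #|V|] covers the case of no path at all, where [hops] takes the value [#|V|]. *)
Lemma hops_ge x y k : (k <= #|V|)%N ->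
  (forall j, (j < k)%N -> paths g x y j = set0) -> (k <= hops g x y)%N.
Proof.
move=> kV no; rewrite leqNgt; apply/negP => lt.
have lt' : (hops g x y < #|V|)%N by exact: leq_trans lt kV.
have : has (fun k => paths g x y k != set0) (iota 0 #|V|) by rewrite has_find size_iota.
by move/(nth_find 0%N); rewrite nth_iota // add0n no ?eqxx.
Qed.

Lemma paths0 x y : x != y -> paths g x y 0 = set0.
Proof. by move=> xy; apply/setP => p; rewrite tuple0 !inE /= (negbTE xy). Qed.

Lemma paths1 x y : ~~ g x y -> paths g x y 1 = set0.
Proof.
move=> xy; apply/setP => p; rewrite !inE; apply/negP => /and3P[].
by case: p => [[|z [|//]]] //= _; rewrite andbT => xz _ /eqP e; move: xy; rewrite -e xz.
Qed.

Lemma paths2 x y : (forall z, g x z -> ~~ g z y) -> paths g x y 2 = set0.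
Proof.
move=> xy; apply/setP => p; rewrite !inE; apply/negP => /and3P[].
case: p => [[|z [|w [|//]]]] //= _; rewrite andbT => /andP[xz zw] _ /eqP e.
by have := xy z xz; rewrite -e zw.
Qed.

Lemma hops_ge1 x y : x != y -> (1 <= hops g x y)%N.
Proof.
move=> xy; apply: hops_ge => [|[] // _]; last exact: paths0.
by apply/card_gt0P; exists x.
Qed.

Lemma hops_ge2 x y : x != y -> ~~ g x y -> (2 <= hops g x y)%N.
Proof.
move=> xy gxy; apply: hops_ge => [|[_|[_|//]]]; [|exact: paths0|exact: paths1].
by apply/card_gt1P; exists x, y.
Qed.

Lemma hops_adjacent x y : g x y -> (hops g x y <= 1)%N.
Proof.
move=> gxy; apply: (@hops_le x y 1 [tuple y]); rewrite !inE /= inE gxy eqxx !andbT /=.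
by apply: contraTneq gxy => ->; rewrite channel_irr.
Qed.

Lemma paths_two x y z : x != y -> g x z -> g z y -> [tuple z; y] \in paths g x y 2.
Proof.
move=> xy gxz gzy; rewrite !inE /= !inE gxz gzy eqxx (negbTE xy) orbF !andbT /=.
apply/andP; split; first by apply: contraTneq gxz => ->; rewrite channel_irr.
by apply: contraTneq gzy => ->; rewrite channel_irr.
Qed.

Lemma nshortest_via_adjacent u x y : g x y -> nshortest_via g u x y = 0%N.
Proof.
move=> gxy; have xy : x != y by apply: contraTneq gxy => ->; rewrite channel_irr.
have e : hops g x y = 1%N by apply/eqP; rewrite eqn_leq hops_adjacent // hops_ge1.
rewrite /nshortest_via e; apply/eqP; rewrite cards_eq0; apply/eqP/setP => p.
rewrite !inE; apply/negP => /and4P[/and3P[_ _]].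
case: p => [[|z [|//]]] //= _ /eqP -> _.
by rewrite inE => /negbTE ->.
Qed.

(** The only candidate is the path [x, u, y]; the boolean bound is read as 0 or 1. *)
Lemma nshortest_via_two u x y : hops g x y = 2%N ->
  (nshortest_via g u x y <= g x u && g u y)%N.
Proof.
rewrite /nshortest_via => ->; set A := [set p in _ | _].
have sub : A \subset [set p : 2.-tuple V | (tval p == [:: u; y]) && (g x u && g u y)].
  apply/subsetP => p; rewrite !inE => /andP[/and3P[]].
  case: p => [[|z [|w [|//]]]] //= _; rewrite andbT => /andP[xz zw] _ /eqP wy.
  rewrite wy !inE => /and3P[_ uy]; rewrite (negbTE uy) orbF => /eqP ->.
  by rewrite eqxx xz -wy zw.
apply: leq_trans (subset_leq_card sub) _.
case: (g x u && g u y); last by rewrite leqn0 cards_eq0; apply/eqP/setP => p; rewrite !inE andbF.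
apply: (@leq_trans #|[set [tuple u; y]]|); last by rewrite cards1.
apply/subset_leq_card/subsetP => p.
by rewrite !inE andbT.
Qed.

Lemma nshortest_two x y z w : hops g x y = 2%N -> x != y -> z != w ->
  g x z -> g z y -> g x w -> g w y -> (2 <= nshortest g x y)%N.
Proof.
rewrite /nshortest => -> xy zw xz zy xw wy; apply/card_gt1P.
exists [tuple z; y], [tuple w; y]; split; try exact: paths_two.
by apply: contra zw => /eqP/(congr1 (fun p => thead p)) /eqP.
Qed.

End Paths.

(** * The share of shortest paths that pass through the deviating leaf *)

Section LeafRatio.
Variables (V : finType) (c u : V) (g : network V).
Hypotheses (gP : deviation u (star c) g).

Lemma star_adjacent x y : x != u -> y != u -> x != y -> (x == c) || (y == c) -> g x y.
Proof. by move=> xu yu xy xyc; rewrite gP //= /star_rel xy. Qed.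

Lemma leaf_distance v1 v2 : v1 != u -> v2 != u -> v1 != v2 -> v1 != c -> v2 != c ->
  u != c -> hops g v1 v2 = 2%N.
Proof.
move=> v1u v2u v12 v1c v2c uc; apply/eqP; rewrite eqn_leq.
rewrite hops_ge2 //; last by rewrite gP // /= /star_rel (negbTE v1c) (negbTE v2c) andbF.
rewrite andbT; apply: (@hops_le _ _ _ _ _ [tuple c; v2]); apply: paths_two => //.
  by rewrite star_adjacent ?eqxx ?orbT // eq_sym.
by rewrite star_adjacent ?eqxx // eq_sym.
Qed.

(** A pair containing the centre is adjacent and needs no intermediary. Two other leaves are at
    distance 2: at most one shortest path uses [u], and if one does, the path through the centre is
    a second one. *)
Lemma via_ratio (R : realType) v1 v2 :
  v1 != u -> v2 != u -> v1 != v2 -> u != c ->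
  (nshortest_via g u v1 v2)%:R / (nshortest g v1 v2)%:R <=
  ((g u v1 && (v1 != c)) && (g u v2 && (v2 != c)))%:R / 2 :> R.
Proof.
move=> v1u v2u v12 uc.
have cu : c != u by rewrite eq_sym.
have [/orP v12c | ] := boolP ((v1 == c) || (v2 == c)).
  by rewrite nshortest_via_adjacent ?mul0r ?divr_ge0 ?ler0n // star_adjacent //; apply/orP.
rewrite negb_or => /andP[v1c v2c]; rewrite v1c v2c !andbT.
have e := leaf_distance v1u v2u v12 v1c v2c uc.
have := nshortest_via_two u e; rewrite (channel_sym g v1 u).
case: (boolP (g u v1 && g u v2)) => [/andP[uv1 uv2]|_]; last first.
  by rewrite leqn0 => /eqP ->; rewrite !mul0r.
have v1c' : g v1 c by rewrite star_adjacent ?eqxx ?orbT.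
have cv2 : g c v2 by rewrite star_adjacent ?eqxx // eq_sym.
have := nshortest_two e v12 cu v1c' cv2; rewrite (channel_sym g v1 u) => /(_ uv1 uv2) m2 m1.
rewrite ler_pdivrMr ?ltr0n 1?ltnW // mulrAC ler_pdivlMr // -!natrM ler_nat; lia.
Qed.
End LeafRatio.

(** * Bounds on fees and utility in an arbitrary network *)

Section Utility.
Variables (R : realType) (s a b l : R) (V : finType).
Hypotheses (hs : 2 <= s) (ha : 0 < a) (hb : 0 < b).
Implicit Types (g : network V) (u v x y : V).

Lemma dist_ge g x y k : (k <= hops g x y)%N -> ((k%:R)%:E <= dist R g x y)%E.
Proof. by rewrite /dist; case: ifP => _ le; rewrite ?leey // lee_fin ler_nat. Qed.

Lemma dist_le g x y k : connect g x y -> (hops g x y <= k)%N ->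
  (dist R g x y <= (k%:R)%:E)%E.
Proof. by rewrite /dist => -> le; rewrite lee_fin ler_nat. Qed.

Lemma dist_ge0 g x y : (0 <= dist R g x y)%E.
Proof. exact: dist_ge (leq0n _). Qed.

Lemma ptrans_ge0 g u v : 0 <= ptrans s g u v.
Proof. by rewrite divr_ge0 ?sumr_ge0 // => *; exact: rf_ge0. Qed.

Lemma ptrans_gt0 g u v : v != u -> 0 < ptrans s g u v.
Proof.
move=> vu; rewrite divr_gt0 ?rf_gt0 // (bigD1 v) //= ltr_wpDr ?rf_gt0 //.
by apply: sumr_ge0 => w _; exact: rf_ge0.
Qed.

(** A real-valued bound [D] on the distances replaces the extended-real fees by a real sum;
    [fees_le] does the same from above. *)
Lemma fees_ge g u (D : V -> R) : (forall v, v != u -> ((D v)%:E <= dist R g u v)%E) ->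
  ((a * \sum_(v | v != u) D v * ptrans s g u v)%:E <= fees s a g u)%E.
Proof.
move=> hD; rewrite EFinM lee_wpmul2l ?lee_fin ?(ltW ha) // -sumEFin.
apply: lee_sum => v vu; rewrite [X in (X <= _)%E]EFinM.
by apply: lee_wpmul2r; [rewrite lee_fin ptrans_ge0 | exact: hD].
Qed.

Lemma fees_le g u (D : V -> R) : (forall v, v != u -> (dist R g u v <= (D v)%:E)%E) ->
  (fees s a g u <= (a * \sum_(v | v != u) D v * ptrans s g u v)%:E)%E.
Proof.
move=> hD; rewrite EFinM lee_wpmul2l ?lee_fin ?(ltW ha) // -sumEFin.
apply: lee_sum => v vu; rewrite [X in (_ <= X)%E]EFinM.
by apply: lee_wpmul2r; [rewrite lee_fin ptrans_ge0 | exact: hD].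
Qed.

Lemma utility_disconnected g u v : v != u -> ~~ connect g u v ->
  utility s a b l g u = -oo%E.
Proof.
move=> vu ncon; rewrite /utility /fees (bigD1 v) //= {1}/dist (negbTE ncon).
(* The other terms are nonnegative, so their sum is not [-oo] and adding it to [+oo] leaves
   [+oo]. *)
rewrite gt0_mulye ?lte_fin ?ptrans_gt0 // addye; last first.
  rewrite gt_eqF // (lt_le_trans (@ltNy0 R)) // sume_ge0 // => w _.
  by rewrite mule_ge0 ?dist_ge0 // lee_fin ptrans_ge0.
by rewrite gt0_muley.
Qed.

Lemma utility_le g u (r F : R) : revenue s b g u <= r -> (F%:E <= fees s a g u)%E ->
  (utility s a b l g u <= (r - F - channel_cost l g u)%:E)%E.
Proof. by move=> hr hF; rewrite !EFinB !leeB ?lee_fin. Qed.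

Lemma utility_ge g u (r F : R) : r <= revenue s b g u -> (fees s a g u <= F%:E)%E ->
  ((r - F - channel_cost l g u)%:E <= utility s a b l g u)%E.
Proof. by move=> hr hF; rewrite !EFinB !leeB ?lee_fin. Qed.

Lemma revenue_ge0 g u : 0 <= revenue s b g u.
Proof.
rewrite mulr_ge0 ?(ltW hb) // sumr_ge0 // => v1 _; rewrite sumr_ge0 // => v2 _.
by rewrite mulr_ge0 ?ptrans_ge0 // divr_ge0 ?ler0n.
Qed.

Lemma ptransE g u v n : #|V| = n.+1 -> ptrans s g u v = rf s g u v / gen_harmonic n s.
Proof. by move=> hV; rewrite /ptrans sum_rf_setC1 cardsC1 hV. Qed.

Lemma network_ext g g' : (forall x y, g x y = g' x y) -> g = g'.
Proof.
case: g g' => [e e_sym e_irr] [e' e_sym' e_irr'] /= ee'.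
have {ee'} ee' : e = e' by apply/funext => x; apply/funext => y.
by subst e'; congr Network; exact: Prop_irrelevance.
Qed.
End Utility.

(** * Revenue, fees and distances of a deviating leaf *)

Section Leaf.
Variables (R : realType) (s a b l : R) (V : finType) (c u : V) (g : network V) (n : nat).
Hypotheses (hs : 2 <= s) (ha : 0 < a) (hb : 0 < b).
Hypotheses (hn : (2 <= n)%N) (hV : #|V| = n.+1).
Hypotheses (uc : u != c) (gP : deviation u (star c) g).
Local Notation H := (gen_harmonic n s).

(** The centre is left out because pairs containing it bring [u] no revenue; a channel to it is
    counted separately. *)
Definition leaf_contacts : {set V} := [set v | g u v && (v != c)].
Local Notation K := leaf_contacts.

Let H_gt0 : 0 < H.
Proof. by rewrite gen_harmonic_gt0 // ltnW. Qed.

(** The ranking seen from [v1] depends on the deviation, so the other contacts are only bounded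
    through [sum_rf_le]. The factor 2 is that of [via_ratio]. *)
Lemma leaf_revenue_from v1 : v1 != u ->
  \sum_(v2 | (v2 != u) && (v1 != v2))
     (nshortest_via g u v1 v2)%:R / (nshortest g v1 v2)%:R * ptrans s g v1 v2 <=
  (v1 \in K)%:R * (gen_harmonic #|K|.-1 s / (2 * H)).
Proof.
move=> v1u.
have uK : u \notin K by rewrite inE channel_irr.
apply: (@le_trans _ _ (\sum_(v2 | (v2 != u) && (v1 != v2))
    (v1 \in K)%:R * (v2 \in K)%:R / 2 * ptrans s g v1 v2)).
  apply: ler_sum => v2 /andP[v2u v12]; rewrite ler_wpM2r ?ptrans_ge0 //.
  by have := via_ratio gP R v1u v2u v12 uc; rewrite -mulnb natrM !inE.
have [v1K|_] := boolP (v1 \in K); last first.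
  by rewrite mul0r big1 // => v2 _; rewrite !mul0r.
rewrite mul1r; under eq_bigr do rewrite mul1r (ptransE _ _ _ _ hV).
have -> : \sum_(v2 | (v2 != u) && (v1 != v2))
     (v2 \in K)%:R / 2 * (rf s g v1 v2 / H) =
   (\sum_(v2 in K :\ v1) rf s g v1 v2) / (2 * H).
  rewrite mulr_suml [RHS]big_mkcond [LHS]big_mkcond; apply: eq_bigr => v2 _.
  rewrite in_setD1 [v1 == _]eq_sym; have [->|_] := eqVneq v2 v1; rewrite ?andbF //= andbT.
  case: eqVneq => [->|_] /=; first by rewrite (negbTE uK).
  case: (v2 \in K); last by rewrite !mul0r.
  by rewrite mul1r invfM mulrCA.
rewrite ler_wpM2r ?invr_ge0 ?mulr_ge0 ?(ltW H_gt0) //.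
have -> : #|K|.-1 = #|K :\ v1| by rewrite [in LHS](cardsD1 v1) v1K.
by rewrite sum_rf_le // !inE eqxx.
Qed.

Lemma leaf_revenue_le : revenue s b g u <= b / H * #|K|.-1%:R.
Proof.
rewrite /revenue -mulrA ler_wpM2l ?(ltW hb) //.
apply: le_trans (ler_sum _ leaf_revenue_from) _.
rewrite -mulr_suml -natr_sum.
have -> : (\sum_(v | v != u) (v \in K) = #|K|)%N.
  rewrite -sum1_card [RHS]big_mkcond [LHS]big_mkcond; apply: eq_bigr => v _.
  by case: eqVneq => [->|_]; [rewrite inE channel_irr | case: (v \in K)].
have [->|K0] := posnP #|K|; first by rewrite mul0r mulr0.
(* With [k = #|K|], summing over the contacts gives [k H_(k-1)^s / (2 H)], and
   [k H_(k-1)^s <= 2 (k - 1)]. *)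
have := gen_harmonic_le #|K|.-1 hs; rewrite (prednK K0) => h.
rewrite invfM mulrCA mulrA mulrA mulrC.
rewrite ler_wpM2l ?invr_ge0 ?(ltW H_gt0) //; lra.
Qed.

(** Here [x] stands for the distance to the centre, and the other weight is 1 on contacts and [y] on
    the remaining leaves. The pair [x, y] is [1, 2] when the channel to the centre is kept and
    [2, 3] when it is dropped. *)
Lemma leaf_fee_sum (x y : R) :
  \sum_(v | v != u)
     (if v == c then x else y - (y - 1) * (v \in K)%:R) * ptrans s g u v =
  (x * rf s g u c +
   (y * n.-1%:R - (y - 1) * #|K|%:R) * ((H - rf s g u c) / n.-1%:R)) / H.
Proof.
have cu : c != u by rewrite eq_sym.
rewrite (bigD1 c) //= eqxx (ptransE _ _ _ _ hV) mulrA mulrDl; congr (_ + _).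
set r := (_ - rf s g u c) / _; rewrite -(card_leaves hV uc) (eq_bigr (fun v =>
  (y - (y - 1) * (v \in K)%:R) * (r / H))) => [|v /andP[vu vc]]; last first.
  by rewrite (negbTE vc) (ptransE _ _ _ _ hV) (rf_leaf hV uc gP s hn vu vc).
rewrite -mulr_suml mulrA; congr (_ * _ / _); rewrite sumrB -mulr_sumr -natr_sum.
congr (_ - _ * _%:R).
  rewrite sumr_const mulr_natr; congr (_ *+ _).
  by apply: eq_card => v; rewrite !inE.
rewrite -sum1_card [RHS]big_mkcond [LHS]big_mkcond; apply: eq_bigr => v _.
rewrite inE; case: (eqVneq v u) => [->|_]; first by rewrite channel_irr.
by case: (v == c); case: (g u v).
Qed.

Lemma leaf_degree : degree g u = (#|K| + g u c)%N.
Proof.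
rewrite /degree (cardsD1 c) inE addnC; congr (_ + _)%N.
by apply: eq_card => v; rewrite !inE andbC.
Qed.

Lemma leaf_hops_ge2 v : v != u -> v != c -> v \notin K -> (2 <= hops g u v)%N.
Proof. by rewrite inE eq_sym => vu vc; rewrite vc andbT => /hops_ge2 ->. Qed.

(** A first step from [u] leads to a leaf other than [u], which is adjacent to no third leaf. *)
Lemma leaf_hops_ge3 v : ~~ g u c -> v != u -> v != c -> v \notin K ->
  (3 <= hops g u v)%N.
Proof.
move=> nuc vu vc; rewrite inE vc andbT => nuv.
have uv : u != v by rewrite eq_sym.
apply: hops_ge => [|[_|[_|[_|//]]]]; [by rewrite hV | exact: paths0 | exact: paths1 |].
apply: paths2 => z uz; have zc : z != c by apply: contraNneq nuc => <-.
have zu : z != u by apply: contraTneq uz => ->; rewrite channel_irr.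
by rewrite gP //= /star_rel (negbTE zc) (negbTE vc) andbF.
Qed.

End Leaf.

(** * No profitable deviation for the centre or for a leaf *)

Section Equilibrium.
Variables (R : realType) (n : nat) (s a b l : R) (V : finType) (c : V).
Hypotheses (hn : (2 <= n)%N) (hs : 2 <= s) (ha : 0 < a) (hb : 0 < b).
Hypothesis hV : #|V| = n.+1.
Local Notation H := (gen_harmonic n s).

Lemma star_connect x y : connect (star c) x y.
Proof.
have cz z : connect (star c) c z.
  by have [->|zc] := eqVneq z c; rewrite ?connect0 // connect1 //= /star_rel eq_sym zc eqxx.
apply: connect_trans (cz y).
by have [->|xc] := eqVneq x c; rewrite ?connect0 // connect1 //= /star_rel xc eqxx orbT.
Qed.

Lemma centre_no_deviation g : deviation c (star c) g ->
  ~ (utility s a b l (star c) c < utility s a b l g c)%E.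
Proof.
move=> gP; have [all_adj|] := boolP [forall v, (v != c) ==> g c v].
  have -> : g = star c.
    apply: network_ext => x y; have [->|xc] := eqVneq x c.
      rewrite /= /star_rel eqxx andbT eq_sym.
      have [->|yc] := eqVneq y c; first by rewrite channel_irr.
      by have /forallP/(_ y)/implyP/(_ yc) := all_adj.
    have [->|yc] := eqVneq y c; last by rewrite gP.
    have /forallP/(_ x)/implyP/(_ xc) := all_adj.
    by rewrite channel_sym => ->; rewrite /= /star_rel xc eqxx orbT.
  by rewrite ltxx.
rewrite negb_forall => /existsP[v]; rewrite negb_imply => /andP[vc ncv].
suff ncon : ~~ connect g c v by rewrite (utility_disconnected s b l ha vc ncon) ltNge leNye.
(* The only possible neighbour of the leaf [v] was the centre, so [v] is now isolated. *)
have /closed_connect clv : closed g (pred1 v).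
  move=> x y xy; rewrite !inE.
  apply/eqP/eqP => [xv|yv]; exfalso; subst.
    have [yc|yc] := eqVneq y c; first by move: ncv; rewrite channel_sym -yc xy.
    by move: xy; rewrite gP //= /star_rel (negbTE vc) (negbTE yc) andbF.
  have [xc|xc] := eqVneq x c; first by move: ncv; rewrite -xc xy.
  by move: xy; rewrite gP //= /star_rel (negbTE vc) (negbTE xc) andbF.
by apply/negP => /clv; rewrite !inE eqxx eq_sym (negbTE vc).
Qed.

Section Leaf.
Variable u : V.
Hypothesis uc : u != c.
(** Computed in the star, [rc] and [rl] keep their values under every deviation of [u]. *)
Let rc := rf s (star c) u c.
Let rl := (H - rc) / n.-1%:R.
Let starP : deviation u (star c) (star c). Proof. by []. Qed.

Lemma star_contacts : leaf_contacts c u (star c) = set0.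
Proof.
by apply/setP => v; rewrite !inE /= /star_rel (negbTE uc); case: (v == c); rewrite ?andbF.
Qed.

(** A lower bound suffices here: revenue is at least 0, the centre is within distance 1 and the
    other leaves within distance 2. *)
Lemma star_leaf_utility :
  ((- (a * ((rc + 2 * n.-1%:R * rl) / H)) - l)%:E <= utility s a b l (star c) u)%E.
Proof.
pose D v : R := if v == c then 1 else 2 - (2 - 1) * (v \in leaf_contacts c u (star c))%:R.
have leD v : v != u -> (dist R (star c) u v <= (D v)%:E)%E.
  move=> vu; rewrite /D star_contacts inE mulr0 subr0.
  have [->|vc] := eqVneq v c.
    by apply: (@dist_le _ _ _ _ _ 1) (star_connect u c) _; rewrite hops_adjacent //= /star_rel uc eqxx orbT.
  apply: (@dist_le _ _ _ _ _ 2) (star_connect u v) _.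
  apply: (@hops_le _ _ _ _ _ [tuple c; v]); apply: paths_two; rewrite 1?eq_sym //= /star_rel ?uc ?eqxx ?orbT //.
  by rewrite eq_sym vc.
have := utility_ge l (revenue_ge0 s hb (star c) u) (fees_le s ha leD).
rewrite (leaf_fee_sum s hn hV uc starP) -/rc -/rl /channel_cost.
rewrite (leaf_degree c) star_contacts cards0 /= /star_rel uc eqxx orbT.
by rewrite mulr0 subr0 mulr1 mul1r sub0r.
Qed.

Lemma leaf_no_deviation g : a / H <= l -> b / H <= l -> deviation u (star c) g ->
  ~ (utility s a b l (star c) u < utility s a b l g u)%E.
Proof.
move=> hal hbl gP; apply/negP; rewrite -leNgt.
apply: le_trans star_leaf_utility.
set K := leaf_contacts c u g; set k := #|K|.
have H0 : 0 < H by rewrite gen_harmonic_gt0 // ltnW.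
have l0 : 0 < l by apply: lt_le_trans hal; rewrite divr_gt0.
have rcE : rf s g u c = rc by rewrite /rc !(rf_centre hV uc).
have m0 : 0 < n.-1%:R :> R by rewrite ltr0n ltn_predRL.
have mrl : n.-1%:R * rl = H - rc by rewrite mulrC divfK ?gt_eqF.
have /andP[rlc rc1] : H - rc <= rc <= 1 by exact: rf_leaves_le_centre.
(* Since [n >= 2] there is another leaf, and [rl] is its ranking factor. *)
have rl0 : 0 <= rl.
  have [v] : exists v, v \in [set v | (v != u) && (v != c)].
    by apply/card_gt0P; rewrite (card_leaves hV uc) ltn_predRL.
  by rewrite inE => /andP[vu vc]; rewrite /rl /rc -(rf_leaf hV uc starP s hn vu vc) rf_ge0.
have km : k%:R <= n.-1%:R :> R.
  rewrite ler_nat -(card_leaves hV uc); apply/subset_leq_card/subsetP => v.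
  by rewrite !inE => /andP[uv ->]; rewrite andbT; apply: contraTneq uv => ->; rewrite channel_irr.
have Krl : k%:R * rl <= n.-1%:R * rl by rewrite ler_wpM2r.
have rev : revenue s b g u <= l * k.-1%:R.
  by apply: le_trans (leaf_revenue_le hs hb hn hV uc gP) _; rewrite ler_wpM2r ?ler0n.
have [ucon|uncon] := boolP (g u c).
  pose D v : R := if v == c then 1 else 2 - (2 - 1) * (v \in K)%:R.
  have geD v : v != u -> ((D v)%:E <= dist R g u v)%E.
    move=> vu; rewrite /D; case: (eqVneq v c) => [_|vc].
      by apply: (@dist_ge _ _ _ _ _ 1); rewrite hops_ge1 // eq_sym.
    have [vK|vK] := boolP (v \in K).
      rewrite mulr1 subKr; apply: (@dist_ge _ _ _ _ _ 1); rewrite hops_ge1 // eq_sym //.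
    rewrite mulr0 subr0; apply: (@dist_ge _ _ _ _ _ 2); exact: (leaf_hops_ge2 (c := c)).
  apply: le_trans (utility_le l rev (fees_ge s ha geD)) _.
  rewrite lee_fin (leaf_fee_sum s hn hV uc gP) rcE -/rl -/K -/k /channel_cost.
  rewrite (leaf_degree c) ucon -/K -/k natrD.
  (* The difference [k - k.-1] is 1 for [k > 0] and 0 for [k = 0], when no fee is saved. For
     [k > 0], [k rl <= H - rc <= 1]. *)
  have key : a / H * (k%:R * rl) <= l * (k%:R - k.-1%:R).
    have [->|k0] := posnP k; first by rewrite mul0r mulr0 subrr mulr0.
    rewrite -[X in X%:R - _](prednK k0) -natr1 addrAC subrr add0r.
    by apply: ler_pM => //; [rewrite divr_ge0 ?ltW | rewrite mulr_ge0 ?ler0n | lra].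
  have -> : a * ((1 * rc + (2 * n.-1%:R - (2 - 1) * k%:R) * rl) / H) =
      a * ((rc + 2 * n.-1%:R * rl) / H) - a / H * (k%:R * rl) by ring.
  by rewrite mulr1n; lra.
(* The channel to the centre is now dropped; if [k = 0] as well, [u] is isolated and has utility
   [-oo]. *)
have [k0|k0] := posnP k.
  have iso v : g u v = false.
    have [->|vc] := eqVneq v c; first exact: negbTE.
    have : v \notin K by move/eqP: k0; rewrite cards_eq0 => /eqP ->; rewrite inE.
    by rewrite inE vc andbT => /negbTE.
  have /closed_connect clu : closed g (pred1 u).
    move=> x y xy; rewrite !inE; apply/eqP/eqP => e; move: xy; rewrite e ?iso //.
    by rewrite channel_sym iso.
  have cu : c != u by rewrite eq_sym.
  rewrite (utility_disconnected s b l ha cu) ?leNye //.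
  by apply/negP => /clu; rewrite !inE eqxx (negbTE cu).
pose D v : R := if v == c then 2 else 3 - (3 - 1) * (v \in K)%:R.
have geD v : v != u -> ((D v)%:E <= dist R g u v)%E.
  move=> vu; rewrite /D; case: (eqVneq v c) => [->|vc].
    by apply: (@dist_ge _ _ _ _ _ 2); rewrite hops_ge2.
  have [vK|vK] := boolP (v \in K).
    by rewrite mulr1 subKr; apply: (@dist_ge _ _ _ _ _ 1); rewrite hops_ge1 // eq_sym.
  rewrite mulr0 subr0; apply: (@dist_ge _ _ _ _ _ 3).
  exact: (leaf_hops_ge3 hn hV gP).
apply: le_trans (utility_le l rev (fees_ge s ha geD)) _.
rewrite lee_fin (leaf_fee_sum s hn hV uc gP) rcE -/rl -/K -/k /channel_cost.
rewrite (leaf_degree c) (negbTE uncon) -/K -/k addn0.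
have -> : k.-1%:R = k%:R - 1 :> R by rewrite -[in RHS](prednK k0) -natr1 addrK.
(* As [k <= n - 1], the product [(2 k - (n - 1)) rl] is at most [(n - 1) rl = H - rc <= rc]. *)
have key : a / H * ((2 * k%:R - n.-1%:R) * rl - rc) <= 0.
  by apply: mulr_ge0_le0; [rewrite divr_ge0 ?ltW | lra].
have -> : a * ((2 * rc + (3 * n.-1%:R - (3 - 1) * k%:R) * rl) / H) =
    a * ((rc + 2 * n.-1%:R * rl) / H) - a / H * ((2 * k%:R - n.-1%:R) * rl - rc) by ring.
lra.
Qed.

End Leaf.
End Equilibrium.

Theorem theorem9 (R : realType) (n : nat) (s a b l : R)
    (V : finType) (c : V)
    (hn : (2 <= n)%N) (hs : 2 <= s)
    (ha : 0 < a) (hb : 0 < b) (hl : 0 < l)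
    (hV : #|V| = n.+1)
    (hal : a / gen_harmonic n s <= l)
    (hbl : b / gen_harmonic n s <= l) :
  nash_equilibrium s a b l (star c).
Proof.
move=> u g; have [->|uc] := eqVneq u c => gP; first exact: centre_no_deviation.
exact: (leaf_no_deviation hn hs ha hb hV uc hal hbl gP).
Qed.
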